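(* Let $\mathcal S=(P,\mathcal L)$ be a $(q,\beta)$-regular partial linear space containing a finite plane $\Pi=(P_\Pi,\mathcal G)$ of order $q$ as a subspace, let $G$ be the point graph of $\mathcal S$, and let $\Gamma_{i,j}$ be the associated twisted partial linear graphs. Assume that $\beta\ge |P_\Pi|+(q+1)^2$. If $\Lambda(G)=\gamma$, then \[ \Lambda(\Gamma_{\lfloor q/2\rfloor,\lfloor q/2\rfloor})\ge \gamma+q+1. \] On the other hand, the $2$-clique extension $G^{[2]}$ has $\lambda$-level at most $\gamma+1$ whenever $G$ is regular.
   Context: All sets and graphs are finite; graphs are simple. For adjacent vertices $x,y$ of a graph $H$ put $\lambda_H(x,y)=|N_H(x)\cap N_H(y)|$; the $\lambda$-level of $H$ is $\Lambda(H)=\#\{\lambda_H(x,y):x\sim y\}$. The $2$-clique extension $G^{[2]}$ is obtained from $G$ by replacing each vertex $x$ by a clique $X$ of order $2$ and joining $X$ completely to $Y$ whenever $x\sim y$ in $G$. A partial linear space is a pair $(P,\mathcal L)$, $\mathcal L$ a set of subsets of $P$ (lines), such that every line has at least two points and every two distinct points lie on at most one line. It is $(s,t)$-regular if every point is on $s+1$ lines and every line has $t+1$ points. $(P',\mathcal L')$ is a subspace of $(P,\mathcal L)$ if $P'\subseteq P$ and $\mathcal L'=\{L\cap P':L\in\mathcal L,\ |L\cap P'|\ge 2\}$. The point graph has vertex set $P$, two distinct points being adjacent iff they lie on a common line. An affine plane of order $q$ is a $(q,q-1)$-regular partial linear space in which for every point $p$ and line $L\not\ni p$ there is a unique line through $p$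 disjoint from $L$; a projective plane of order $q$ is a $(q,q)$-regular partial linear space in which any two distinct lines meet in exactly one point. A finite plane of order $q$ is either of these. Throughout $q\ge2$. Construction. Let $\mathcal S$, $\Pi$ be as in the claim. For every $g\in\mathcal G$ there is a unique line $L(g)\in\mathcal L$ with $L(g)\cap P_\Pi=g$. Fix a line $\ell_0\in\mathcal G$ and $q$ distinct points $u_1,\dots,u_q\in\ell_0$. For each $a\in[q]=\{1,\dots,q\}$ let $\{\ell_0,\ell_{a,1},\dots,\ell_{a,q}\}$ be the set of the $q+1$ lines of $\Pi$ through $u_a$; when $\Pi$ is affine, the labels are chosen so that for each fixed $b\in[q]$ the lines $\ell_{1,b},\dots,\ell_{q,b}$ are pairwise parallel (disjoint). Put $L_0=L(\ell_0)$, $L_{a,b}=L(\ell_{a,b})$, and $\widetilde a=q+1-a$. For $1\le a\le\lfloor q/2\rfloor$ and $b\in[q]$, twisting the pair $(L_{a,b},L_{\widetilde a,b})$ means replacing these two lines by $(L_{a,b}\setminus\ell_{a,b})\cup\ell_{\widetilde a,b}$ and $(L_{\widetilde a,b}\setminus\ell_{\widetilde a,b})\cup\ell_{a,b}$, respectively, all other lines being kept. For $1\le i\le\lfloor q/2\rfloor$ and $0\le j\le i$ let $T_{i,j}=\{(a,b):1\le a<i,\ 1\le b\le a\}\cup\{(i,b):1\le b\le j\}$, and $T_{0,0}=\varnothing$. Let $P^+=\{x^+:x\in P\}$ and $P^-=\{x^-:x\in P\}$ be disjoint copies of $P$. For each line label $L\in\mathcal L$, let $L^+=\{x^+:x\in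 L\}$, and let $L^-\subseteq P^-$ be the copy in $P^-$ of the line that replaces $L$ after twisting all pairs $(L_{a,b},L_{\widetilde a,b})$ with $(a,b)\in T_{i,j}$ (the copy of $L$ itself if $L$ is not in such a pair). The twisted partial linear graph $\Gamma_{i,j}$ ($0\le j\le i\le\lfloor q/2\rfloor$) has vertex set $P^+\cup P^-$; two distinct vertices $x^\varepsilon,y^\delta$ ($\varepsilon,\delta\in\{+,-\}$) are adjacent iff (1) $x,y\in P_\Pi$, or (2) there is a line label $L\in\mathcal L$ with $x^\varepsilon\in L^\varepsilon$ and $y^\delta\in L^\delta$. *)

(* Defs.v *)
From mathcomp Require Import all_boot.

Set Implicit Arguments.
Unset Strict Implicit.
Unset Printing Implicit Defensive.

(* A simple graph is an adjacency relation on a finType;                      *)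
(* every relation built below is symmetric and irreflexive.                   *)

Section Graphs.
Variables (V : finType) (e : rel V).

Definition nbhd (x : V) : {set V} := [set y | e x y].

Definition lambda (x y : V) : nat := #|nbhd x :&: nbhd y|.

Definition lambda_level : nat :=
  size (undup [seq lambda p.1 p.2 | p <- enum [pred p : V * V | e p.1 p.2]]).

Definition regular_graph : Prop := exists k : nat, forall x, #|nbhd x| = k.

(* Each vertex x becomes the clique {(x, true), (x, false)}. *)
Definition clique_ext2 : rel (V * bool) :=
  fun v w => (v != w) && ((v.1 == w.1) || e v.1 w.1).

End Graphs.

Section Geometries.
Variable T : finType.
Implicit Types (P PPi : {set T}) (LL GG : {set {set T}}) (q s t : nat).

Definition partial_linear_space P LL : Prop :=
  [/\ forall L, L \in LL -> L \subset P,
      forall L, L \in LL -> 2 <= #|L|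
    & forall x y, x \in P -> y \in P -> x != y ->
        #|[set L in LL | (x \in L) && (y \in L)]| <= 1].

Definition regular_pls s t P LL : Prop :=
  [/\ partial_linear_space P LL,
      forall x, x \in P -> #|[set L in LL | x \in L]| = s.+1
    & forall L, L \in LL -> #|L| = t.+1].

Definition subspace PPi GG P LL : Prop :=
  PPi \subset P /\
  GG = [set L :&: PPi | L in [set L in LL | 2 <= #|L :&: PPi|]].

Definition point_graph LL : rel T :=
  fun x y => (x != y) && [exists L in LL, (x \in L) && (y \in L)].

Definition affine_plane q PPi GG : Prop :=
  regular_pls q q.-1 PPi GG /\
  forall p L, p \in PPi -> L \in GG -> p \notin L ->
    exists! M, [/\ M \in GG, p \in M & [disjoint M & L]].

Definition projective_plane q PPi GG : Prop :=
  regular_pls q q PPi GG /\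
  forall L M, L \in GG -> M \in GG -> L != M -> #|L :&: M| = 1.

Definition finite_plane q PPi GG : Prop :=
  affine_plane q PPi GG \/ projective_plane q PPi GG.

End Geometries.

(* The index set {1, ..., q} is represented by 'I_q, so that the ordinal a    *)
(* stands for the index a + 1, and rev_ord a for (q + 1) - (a + 1).           *)

Section Twisting.
Variables (T : finType) (q : nat).
Variables (LL : {set {set T}}) (PPi : {set T}) (GG : {set {set T}}).

(* The q + 1 lines listed in the fourth clause are automatically distinct     *)
(* when Pi is a plane of order q, since exactly q + 1 lines pass through u a. *)
Definition plane_labelling
    (l0 : {set T}) (u : 'I_q -> T) (l : 'I_q -> 'I_q -> {set T}) : Prop :=
  [/\ l0 \in GG,
      injective u,
      forall a, u a \in l0,
      forall a, l0 |: [set l a b | b : 'I_q] = [set g in GG | u a \in g]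
    & affine_plane q PPi GG ->
        forall a a' b, a != a' -> [disjoint l a b & l a' b]].

(* The default value set0 is never used for g in GG when Pi is a subspace.    *)
Definition line_ext (g : {set T}) : {set T} :=
  odflt set0 [pick L in LL | L :&: PPi == g].

Definition twist_index (i j : nat) (a b : 'I_q) : bool :=
  (a.+1 < i) && (b <= a) || (a.+1 == i) && (b < j).

Variable l : 'I_q -> 'I_q -> {set T}.

(* The line replacing L. Both lines of a twisted pair follow the same rule:   *)
(* the one with label (a, b) receives the plane line l (rev_ord a) b.         *)
Definition twisted_line (i j : nat) (L : {set T}) : {set T} :=
  if [pick ab : 'I_q * 'I_q
       | (twist_index i j ab.1 ab.2 || twist_index i j (rev_ord ab.1) ab.2)
         && (L == line_ext (l ab.1 ab.2))] is Some (a, b)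
  then (L :\: l a b) :|: l (rev_ord a) b
  else L.

(* The vertices x^+ and x^- are (x, true) and (x, false). *)
Definition twisted_graph (i j : nat) : rel (T * bool) :=
  let copy (L : {set T}) (eps : bool) :=
    if eps then L else twisted_line i j L in
  fun v w => (v != w) &&
    ((v.1 \in PPi) && (w.1 \in PPi) ||
     [exists L in LL, (v.1 \in copy L v.2) && (w.1 \in copy L w.2)]).

End Twisting.

(* Main.v *)
(* Replacing each vertex by its two copies, an edge x y of G becomes the edge x^+ y^+ of
   Gamma with 2 lambda_G(x, y) + 2 common neighbours, which gives gamma levels, all between
   2 beta and 2 beta + 2 (q + 1)^2.
   For x, y in Pi, let c be the number of line labels L with x^+ in L^+ and y^- in L^-.  All
   points of Pi are common neighbours of x^+ and y^-, and outside Pi each of these c labels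
   contributes beta + 1 - k points in each copy, where k is the size of the lines of Pi; the
   remaining pairs of lines contribute at most (q + 1)^2 points per copy.  Since beta is
   large, distinct c give distinct levels, and c <> 1 gives levels that do not come from G.
   The value c = a + 1 is reached by (u_a^+, u_b^-) with a + b = q + 1, c = q + 1 - a by
   (u_a^+, u_a^-), for a <= q/2, and c = 0 by u_1 and the common point of the lines
   l_(1,1) and l_(q,2): these are the q values 0, 2, ..., q.  The last level 2 (q + 1) beta
   is that of x^+ x^- for x outside Pi. *)
Require Import Defs.
From mathcomp Require Import all_boot.
From mathcomp Require Import zify.

Set Implicit Arguments.
Unset Strict Implicit.
Unset Printing Implicit Defensive.

(** * Levels of a graph *)

Section LambdaLevel.
Variables (V : finType) (e : rel V).

Lemma lambda_levelP : exists s : seq nat,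
  [/\ uniq s, size s = lambda_level e
    & forall n, n \in s <-> exists x y, e x y /\ lambda e x y = n].
Proof.
exists (undup [seq lambda e p.1 p.2 | p <- enum [pred p : V * V | e p.1 p.2]]).
split; [exact: undup_uniq | by [] | move=> n; rewrite mem_undup; split].
  by case/mapP=> -[x y]; rewrite mem_enum inE /= => exy ->; exists x, y.
case=> x [y [exy <-]]; apply/mapP; exists (x, y) => //.
by rewrite mem_enum inE.
Qed.

Lemma leq_lambda_level (s : seq nat) :
  uniq s -> (forall n, n \in s -> exists x y, e x y /\ lambda e x y = n) ->
  size s <= lambda_level e.
Proof.
have [s' [_ <- s'P]] := lambda_levelP => s_uniq sP.
by apply: uniq_leq_size => // n /sP /s'P.
Qed.

Lemma lambda_level_leq (s : seq nat) :
  (forall x y, e x y -> lambda e x y \in s) -> lambda_level e <= size s.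
Proof.
have [s' [s'_uniq <- s'P]] := lambda_levelP => sP.
by apply: uniq_leq_size => // n /s'P [x [y [/sP ? <-]]].
Qed.

(** Common neighbours are easier to count for the reflexive closure [r] of the adjacency: the
    vertices v and w then lie in both closed neighbourhoods and account for the 2. *)
Lemma lambda_closed_nbhd (r : rel V) (v w : V) :
  (forall x, r x x) -> r v w -> r w v -> v != w -> (e =2 fun x y => (x != y) && r x y) ->
  lambda e v w + 2 = #|[set z | r v z && r w z]|.
Proof.
move=> rr rvw rwv vw eE.
have -> : lambda e v w = #|[set z | r v z && r w z] :\: [set v; w]|.
  apply: eq_card => z; rewrite !inE !eE negb_or ![_ == z]eq_sym.
  by case: (z != v); case: (z != w); rewrite //= andbF.
rewrite cardsD (setIidPr _) ?cards2 ?vw ?subnK //.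
  rewrite -[2]/((true).+1) -[true]vw -cards2 subset_leq_card //.
  by apply/subsetP=> z /set2P[] ->; rewrite inE ?rr ?rvw ?rwv.
by apply/subsetP=> z /set2P[] ->; rewrite inE ?rr ?rvw ?rwv.
Qed.

End LambdaLevel.

Lemma card_pair_bool (T : finType) (p : pred (T * bool)) :
  #|[set w | p w]| = #|[set z | p (z, true)]| + #|[set z | p (z, false)]|.
Proof.
have -> : [set w | p w] = (pair^~ true @: [set z | p (z, true)])
                      :|: (pair^~ false @: [set z | p (z, false)]).
  apply/setP=> -[z b]; rewrite !inE; apply/idP/orP => [pzb|].
    by case: b pzb => pzb; [left|right]; apply/imsetP; exists z; rewrite ?inE.
  by case=> /imsetP[z']; rewrite inE => ? [-> ->].
rewrite cardsU (_ : _ :&: _ = set0) ?cards0 ?subn0 ?card_imset //; do ?by move=> ? ? [].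
apply/setP=> -[z b]; rewrite !inE; apply/negP.
by case/andP=> /imsetP[? _ [_ ->]] /imsetP[? _].
Qed.

Lemma card_split (T : finType) (W : {set T}) (p : pred T) :
  #|[set z | p z]| = #|[set z in W | p z]| + #|[set z in ~: W | p z]|.
Proof.
rewrite -(cardsID W); congr (_ + _); apply: eq_card => z; rewrite !inE //.
by rewrite andbC.
Qed.

(** Closed neighbourhoods double in size. An edge from distinct x and y thus has 2 (lambda + 2) - 2
    common neighbours, while the two copies of one vertex have 2 (k + 1) - 2 = 2 k, a single extra
    value by regularity. *)
Lemma lambda_level_clique_ext2 (V : finType) (e : rel V) :
  irreflexive e -> symmetric e -> regular_graph e ->
  lambda_level (clique_ext2 e) <= lambda_level e + 1.
Proof.
move=> e_irr e_sym [k deg_k]; have [s [_ <- sP]] := lambda_levelP e.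
pose r (x y : V) := (x == y) || e x y.
have r_refl x : r x x by rewrite /r eqxx.
have rE : clique_ext2 e =2 fun v w => (v != w) && r v.1 w.1 by [].
have eE : e =2 fun x y => (x != y) && r x y.
  by move=> x y; rewrite /r; case: eqP => //= <-; exact: e_irr.
have -> : size s + 1 = size (2 * k :: [seq 2 * n + 2 | n <- s]).
  by rewrite /= size_map addn1.
apply: lambda_level_leq => -[x b] [y c]; rewrite rE /= => /andP[vw rxy].
have ryx : r y x by rewrite /r eq_sym e_sym.
have /= := lambda_closed_nbhd (r := fun v w => r v.1 w.1) (v := (x, b)) (w := (y, c))
  (fun v => r_refl v.1) rxy ryx vw rE.
rewrite (card_pair_bool (fun z => r x z.1 && r y z.1)) /=.
case: (eqVneq x y) => [xy|xy].
  have -> : #|[set z | r x z && r y z]| = k.+1.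
    rewrite -(deg_k x) -[in LHS]xy.
    have -> : [set z | r x z && r x z] = x |: nbhd e x.
      by apply/setP=> z; rewrite !inE andbb eq_sym.
    by rewrite cardsU1 inE e_irr.
  move=> lamE; rewrite inE; apply/orP; left; apply/eqP; lia.
have exy : e x y by rewrite eE xy.
rewrite -(lambda_closed_nbhd r_refl rxy ryx xy eE) => lamE.
rewrite inE; apply/orP; right; apply/mapP; exists (lambda e x y); last by lia.
by apply/sP; exists x, y.
Qed.

(** * Counting points covered by two families of sets *)

Section Covers.
Variables (T I : finType).
Implicit Types (W : {set T}) (A B : {set I}) (f : I -> {set T}).

(** For the pencils of two points this is the set of points collinear with both. The index type is
    arbitrary so that the plane can later join the lines as an extra index. *)
Definition meeting_set f A B : {set T} :=
  [set z | [exists i in A, z \in f i] && [exists j in B, z \in f j]].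

Definition disjoint_on W f A : Prop :=
  forall z i j, z \in W -> i \in A -> j \in A -> z \in f i -> z \in f j -> i = j.

Lemma disjoint_on_sum W f A z : disjoint_on W f A -> z \in W ->
  \sum_(i in A) (z \in f i) = [exists i in A, z \in f i].
Proof.
move=> dis zW; case: existsP => [[i /andP[iA zi]]|noi].
  rewrite (bigD1 i) //= zi big1 ?addn0 // => j /andP[jA ji].
  by apply/eqP; rewrite eqb0; apply: contraNN ji => zj; rewrite (dis z j i).
rewrite big1 // => i iA; apply/eqP; rewrite eqb0; apply/negP => zi.
by case: noi; exists i; rewrite iA.
Qed.

(** On W each family covers a point at most once, so the indicator of being covered by both is a
    product of two sums of indicators; expanding it gives the double sum. *)
Lemma card_meeting_disjoint W f A B : disjoint_on W f A -> disjoint_on W f B ->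
  #|W :&: meeting_set f A B| = \sum_(i in A) \sum_(j in B) #|f i :&: f j :&: W|.
Proof.
move=> disA disB.
have cardE (S : {set T}) : #|S :&: W| = \sum_(z in W) (z \in S).
  rewrite -sum1_card big_mkcond [RHS]big_mkcond /=; apply: eq_bigr => z _.
  by rewrite inE; case: (z \in W); case: (z \in S).
rewrite setIC cardE.
under [RHS]eq_bigr => i _ do (under eq_bigr => j _ do rewrite cardE; rewrite exchange_big /=).
rewrite exchange_big /=; apply: eq_bigr => z zW.
rewrite inE -mulnb -!(disjoint_on_sum _ zW) // big_distrl /=.
apply: eq_bigr => i _; rewrite big_distrr /=; apply: eq_bigr => j _.
by rewrite inE mulnb.
Qed.

Lemma card_meeting_lower W f A B : disjoint_on W f (A :&: B) ->
  \sum_(i in A :&: B) #|W :&: f i| <= #|W :&: meeting_set f A B|.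
Proof.
move=> dis; rewrite (eq_bigr (fun i => \sum_(z in W) (z \in f i))); last first.
  move=> i _; rewrite -sum1_card big_mkcond [RHS]big_mkcond /=; apply: eq_bigr => z _.
  by rewrite inE; case: (z \in W); case: (z \in f i).
rewrite exchange_big /=.
rewrite -sum1_card [X in _ <= X]big_mkcond [X in X <= _]big_mkcond /= leq_sum // => z _.
rewrite !inE; case: ifP => //= zW; rewrite (disjoint_on_sum dis zW).
case: existsP => // -[i /andP[]]; rewrite inE => /andP[iA iB] zi.
by rewrite ifT //; apply/andP; split; apply/existsP; exists i; rewrite ?iA ?iB.
Qed.

(** A covered point lies on a set of a common index or in the intersection of two sets of different
    indices; there are at most [#|A| * #|B|] such pairs, each giving at most one point. *)
Lemma card_meeting_upper W f A B :
  (forall i j, i \in A -> j \in B -> i != j -> #|f i :&: f j| <= 1) ->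
  #|W :&: meeting_set f A B| <= \sum_(i in A :&: B) #|W :&: f i| + #|A| * #|B|.
Proof.
move=> meet1.
pose X := \bigcup_(i in A :&: B) (W :&: f i).
pose Y := \bigcup_(p in setX A B) (if p.1 == p.2 then set0 else f p.1 :&: f p.2).
have sub : W :&: meeting_set f A B \subset X :|: Y.
  apply/subsetP=> z /setIP[zW]; rewrite inE => /andP[].
  case/existsP=> i /andP[iA zi] /existsP[j /andP[jB zj]]; rewrite inE.
  case: (eqVneq i j) => [ij|ij]; apply/orP.
    by left; apply/bigcupP; exists i; rewrite inE ?iA ?zW // ij.
  right; apply/bigcupP; exists (i, j); rewrite ?inE /= ?iA //.
  by rewrite (negbTE ij) inE zi zj.
have card_bigcup (J : finType) (P : {set J}) (g : J -> {set T}) :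
    #|\bigcup_(i in P) g i| <= \sum_(i in P) #|g i|.
  elim/big_ind2: _ => [|a m b n am bn|//]; first by rewrite cards0.
  by apply: leq_trans (leq_add am bn); apply: leq_card_setU.
apply: leq_trans (subset_leq_card sub) _; apply: leq_trans (leq_card_setU _ _) _.
apply: leq_add; first exact: card_bigcup.
apply: leq_trans (card_bigcup _ _ _) _; rewrite -cardsX -[X in _ <= X]sum1_card.
apply: leq_sum => -[i j] /setXP[iA jB] /=.
by case: eqVneq => [|ij]; rewrite ?cards0 ?meet1.
Qed.

End Covers.

(** Levels will be known only up to an error term; separated intervals suffice to count them as
    distinct. *)
Lemma staircase (vals : nat -> Prop) (lo hi : nat -> nat) (n : nat) :
  (forall i, i < n -> exists2 v, vals v & lo i <= v <= hi i) ->
  (forall i, i.+1 < n -> hi i < lo i.+1) ->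
  exists s : seq nat, [/\ uniq s, size s = n, forall v, v \in s -> vals v
    & forall v, v \in s -> lo 0 <= v <= hi n.-1].
Proof.
move=> valsP gap.
(* The bound on all [lo i] is added to the induction hypothesis so that the new value is known to
   lie above [lo 0]. *)
suff [s [s1 s2 s3 s4 _]] : exists s : seq nat, [/\ uniq s, size s = n,
    forall v, v \in s -> vals v, forall v, v \in s -> lo 0 <= v <= hi n.-1 &
    forall i, i < n -> lo 0 <= lo i <= hi n.-1] by exists s.
elim: n => [|n IHn] in valsP gap *; first by exists [::].
have [s [us ss sv sb lob]] := IHn (fun i h => valsP i (leqW h)) (fun i h => gap i (leqW h)).
have [v vv /andP[lov vhi]] := valsP n (leqnn _).
have below : 0 < n -> hi n.-1 < lo n.
  by move=> n_gt0; have := gap n.-1; rewrite prednK //; apply.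
have lo0 : lo 0 <= lo n.
  by case: n {IHn valsP gap lov vhi sb} lob below ss => [//|n] lob below ss;
    have := lob 0 isT; have := below isT; lia.
have sn w : w \in s -> 0 < n by rewrite -ss; case: (s).
exists (v :: s); split => /=.
- rewrite us andbT; apply/negP => vs; have := below (sn _ vs); have := sb _ vs; lia.
- by rewrite ss.
- by move=> w; rewrite inE => /predU1P[->|/sv].
- move=> w; rewrite inE => /predU1P[->|ws]; first by lia.
  by have := below (sn _ ws); have := sb _ ws; lia.
move=> i; rewrite ltnS leq_eqVlt => /predU1P[->|lt_in]; first by lia.
have := lob i lt_in; have := below (leq_ltn_trans (leq0n i) lt_in); lia.
Qed.

(** * Partial linear spaces and their planes *)

Section PartialLinearSpaces.
Variables (T : finType) (P : {set T}) (LL : {set {set T}}) (s t : nat).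
Hypothesis pls : regular_pls s t P LL.

Definition pencil (x : T) : {set {set T}} := [set L in LL | x \in L].

Lemma mem_pencil L x : (L \in pencil x) = (L \in LL) && (x \in L).
Proof. by rewrite inE. Qed.

Lemma card_pencil x : x \in P -> #|pencil x| = s.+1.
Proof. by have [_ h _] := pls; apply: h. Qed.

Lemma card_line L : L \in LL -> #|L| = t.+1.
Proof. by have [_ _ h] := pls; apply: h. Qed.

Lemma line_sub L : L \in LL -> L \subset P.
Proof. by have [[h _ _] _ _] := pls; apply: h. Qed.

Lemma line_eq L M x y : L \in LL -> M \in LL -> x != y ->
  x \in L -> y \in L -> x \in M -> y \in M -> L = M.
Proof.
move=> LLL MLL xy xL yL xM yM; have [[sub _ h] _ _] := pls.
have := h x y (subsetP (sub L LLL) x xL) (subsetP (sub L LLL) y yL) xy.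
move=> /card_le1_eqP; apply; by rewrite inE ?LLL ?MLL ?xL ?yL ?xM.
Qed.

Lemma lines_meet L M : L \in LL -> M \in LL -> L != M -> #|L :&: M| <= 1.
Proof.
move=> LLL MLL; apply: contraR; rewrite -ltnNge => /card_gt1P[x [y [xi yi xy]]].
by move: xi yi; rewrite !inE => /andP[? ?] /andP[? ?]; rewrite (line_eq LLL MLL xy).
Qed.

Lemma pencil_exists x : x \in P -> exists L, L \in pencil x.
Proof. by move=> xP; apply/set0Pn; rewrite -card_gt0 card_pencil. Qed.

Lemma pencil_disjoint (W : {set T}) x : x \notin W -> disjoint_on W id (pencil x).
Proof.
move=> xW z L M zW; rewrite !mem_pencil => /andP[LLL xL] /andP[MLL xM] zL zM.
by apply: (line_eq (x := x) (y := z)) => //; apply: contraNneq xW => ->.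
Qed.

End PartialLinearSpaces.

(** * Common neighbours in the point graph *)

Section PointGraph.
Variables (T : finType) (LL : {set {set T}}) (q beta : nat).
Hypothesis pls : regular_pls q beta [set: T] LL.

Definition collinear (x y : T) := [exists L in LL, (x \in L) && (y \in L)].

Lemma collinear_pencil x y : collinear x y = [exists L in pencil LL x, y \in L].
Proof. by apply: eq_existsb => L; rewrite mem_pencil andbA. Qed.

Lemma collinear_sym x y : collinear x y = collinear y x.
Proof. by apply: eq_existsb => L; rewrite [X in _ && X]andbC. Qed.

Lemma collinear_refl x : collinear x x.
Proof.
have [L] := pencil_exists pls (in_setT x); rewrite mem_pencil => /andP[LLL xL].
by apply/existsP; exists L; rewrite LLL xL.
Qed.

Lemma lambda_point_graph x y : x != y -> collinear x y ->
  lambda (point_graph LL) x y + 2 = #|[set z | collinear x z && collinear y z]|.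
Proof.
move=> xy cxy; apply: lambda_closed_nbhd => //; first exact: collinear_refl.
by rewrite collinear_sym.
Qed.

Lemma collinear_meeting x y :
  [set z | collinear x z && collinear y z] = meeting_set id (pencil LL x) (pencil LL y).
Proof. by apply/setP=> z; rewrite !inE !collinear_pencil. Qed.

(** The unique line through x and y gives [beta.+1] points; the other pairs of a line through x and
    a line through y give at most one point each. *)
Lemma lambda_point_graph_bounds x y : x != y -> collinear x y ->
  beta.+1 <= lambda (point_graph LL) x y + 2 <= beta.+1 + (q + 1) ^ 2.
Proof.
move=> xy cxy; rewrite lambda_point_graph // collinear_meeting.
have /existsP[L /and3P[LLL xL yL]] := cxy.
have LE : pencil LL x :&: pencil LL y = [set L].
  apply/setP=> M; rewrite in_setI in_set1 !mem_pencil.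
  apply/idP/eqP => [/andP[/andP[MLL xM] /andP[_ yM]]|->]; last by rewrite LLL xL yL.
  exact: (line_eq pls (x := x) (y := y)).
apply/andP; split.
  rewrite -(card_line pls LLL) subset_leq_card //; apply/subsetP=> z zL.
  by rewrite inE; apply/andP; split; apply/existsP; exists L; rewrite mem_pencil LLL ?xL ?yL.
rewrite -(setTI (meeting_set _ _ _)).
have meet1 (M N : {set T}) : M \in pencil LL x -> N \in pencil LL y -> M != N -> #|M :&: N| <= 1.
  by rewrite !mem_pencil => /andP[? _] /andP[? _]; exact: (lines_meet pls).
apply: leq_trans (card_meeting_upper (f := id) setT meet1) _.
by rewrite LE big_set1 setTI (card_line pls LLL) !(card_pencil pls) // addn1 mulnn.
Qed.

(** The q + 1 lines through x are disjoint away from x, with beta further points each. *)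
Lemma card_collinear x : ((q + 1) * beta).+1 <= #|[set z | collinear x z]|.
Proof.
have -> : [set z | collinear x z] = meeting_set id (pencil LL x) (pencil LL x).
  by rewrite -collinear_meeting; apply/setP=> z; rewrite !inE andbb.
rewrite (cardsD1 x) -add1n leq_add //.
  by rewrite inE andbb -collinear_pencil collinear_refl.
rewrite setDE setIC; apply: leq_trans (card_meeting_lower _); last first.
  by rewrite setIid; apply: (pencil_disjoint pls); rewrite !inE eqxx.
rewrite setIid (eq_bigr (fun=> beta)) => [|L]; last first.
  rewrite mem_pencil => /andP[LLL xL].
  by have := cardsD1 x L; rewrite xL (card_line pls LLL) setIC -setDE add1n => -[].
by rewrite sum_nat_const (card_pencil pls) // addn1.
Qed.

End PointGraph.

(** * Finite planes: collinearity and parallelism *)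

Section Planes.
Variables (T : finType) (q : nat) (PPi : {set T}) (GG : {set {set T}}).
Hypothesis q_ge2 : 2 <= q.

Lemma finite_plane_regular : finite_plane q PPi GG ->
  exists2 t, 0 < t & regular_pls q t PPi GG.
Proof. by case=> -[? _]; [exists q.-1; first lia | exists q; first lia]. Qed.

(** Take a line L through y that misses x. At least [#|L|] lines through x meet L: all q + 1 of them
    in the projective case, all but the parallel to L in the affine case. They meet L in different
    points, hence cover it, and y is on one of them. *)
Lemma plane_collinear x y : finite_plane q PPi GG ->
  x \in PPi -> y \in PPi -> collinear GG x y.
Proof.
move=> plane xP yP; have [t _ pls] := finite_plane_regular plane.
have [L] := pencil_exists pls yP; rewrite mem_pencil => /andP[LGG yL].
rewrite collinear_pencil; have [xL|xL] := boolP (x \in L).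
  by apply/existsP; exists L; rewrite mem_pencil LGG xL.
suff [A subA [cardA meetA]] : exists2 A : {set {set T}}, A \subset pencil GG x & #|L| <= #|A| /\
    forall M, M \in A -> 0 < #|L :&: M|.
  have disA : disjoint_on L id A.
    by move=> z M N zL MA NA; apply: (pencil_disjoint pls xL) => //; apply: (subsetP subA).
  have : #|L| <= #|L :&: meeting_set id A A|.
    apply: leq_trans (card_meeting_lower _); last by rewrite setIid.
    rewrite setIid; apply: leq_trans cardA _; rewrite -sum1_card; exact: leq_sum.
  rewrite leqNgt => cardL; have /eqP LE : L == L :&: meeting_set id A A.
    by rewrite eq_sym eqEcard subsetIl leqNgt.
  move: yL; rewrite LE !inE => /and3P[_ /existsP[M /andP[MA yM]] _].
  by apply/existsP; exists M; rewrite (subsetP subA).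
case: plane => -[pls' h].
  have [D [[DGG xD disD] uniqD]] := h x L xP LGG xL.
  exists (pencil GG x :\ D); first exact: subD1set.
  split=> [|M].
    have := cardsD1 D (pencil GG x).
    by rewrite mem_pencil DGG xD (card_pencil pls' xP) (card_line pls' LGG); lia.
  rewrite !inE => /and3P[MD MGG xM]; rewrite card_gt0.
  apply: contraNneq MD => LM; apply/eqP; apply/esym/uniqD; split=> //.
  by rewrite disjoint_sym -setI_eq0 LM.
exists (pencil GG x) => //; split=> [|M].
  by rewrite (card_pencil pls' xP) (card_line pls' LGG).
rewrite mem_pencil => /andP[MGG xM]; rewrite h //.
by apply: contraNneq xL => ->.
Qed.

Definition parallel (g h : {set T}) := (g == h) || [disjoint g & h].

Lemma parallel_sym g h : parallel g h = parallel h g.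
Proof. by rewrite /parallel eq_sym disjoint_sym. Qed.

(** If g and k share a point off h, both are the unique parallel to h through it. *)
Lemma parallel_trans g h k : affine_plane q PPi GG ->
  g \in GG -> h \in GG -> k \in GG -> parallel g h -> parallel h k -> parallel g k.
Proof.
move=> [pls par] gG hG kG /predU1P[->//|gh] /predU1P[<-|hk]; first by rewrite /parallel gh orbT.
rewrite /parallel -setI_eq0; have [->|[p]] := set_0Vmem (g :&: k); first by rewrite eqxx orbT.
rewrite inE => /andP[pg pk]; have ph : p \notin h by rewrite (disjointFr gh).
have [D [_ uniqD]] := par p h (subsetP (line_sub pls gG) p pg) hG ph.
by rewrite -(uniqD g) // -(uniqD k) ?eqxx // disjoint_sym.
Qed.

End Planes.

(** * Traces of lines on an embedded plane *)

Section Subspaces.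
Variables (T : finType) (LL : {set {set T}}) (q beta : nat).
Variables (PPi : {set T}) (GG : {set {set T}}).
Hypothesis q_ge2 : 2 <= q.
Hypothesis pls : regular_pls q beta [set: T] LL.
Hypothesis plane : finite_plane q PPi GG.
Hypothesis sub : subspace PPi GG [set: T] LL.

(** The q + 1 plane lines through x are traces of lines through x. As x is on just q + 1 lines in
    all, every one of these has a plane line as its trace. *)
Lemma trace_mem L x : L \in LL -> x \in L -> x \in PPi -> L :&: PPi \in GG.
Proof.
have [t _ plsG] := finite_plane_regular q_ge2 plane; have [_ GE] := sub.
move=> LLL xL xP.
pose A := [set M in pencil LL x | 2 <= #|M :&: PPi|].
have subA : A \subset pencil LL x by apply/subsetP=> M; rewrite inE => /andP[].
have imA : pencil GG x = [set M :&: PPi | M in A].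
  apply/setP=> g; rewrite mem_pencil GE; apply/andP/imsetP.
    case=> /imsetP[M]; rewrite inE => /andP[MLL M2] ->; rewrite inE => /andP[xM _].
    by exists M; rewrite // inE mem_pencil MLL xM.
  case=> M; rewrite inE mem_pencil => /andP[/andP[MLL xM] M2] ->.
  by split; [apply/imsetP; exists M; rewrite ?inE ?MLL | rewrite inE xM].
have AE : A = pencil LL x.
  apply/eqP; rewrite eqEcard subA (card_pencil pls) ?inE //.
  by rewrite -(card_pencil plsG xP) imA leq_imset_card.
rewrite GE; apply: imset_f; rewrite inE LLL.
have : L \in A by rewrite AE mem_pencil LLL.
by rewrite inE => /andP[].
Qed.

Lemma trace_inj L M : L \in LL -> M \in LL -> L :&: PPi \in GG ->
  L :&: PPi = M :&: PPi -> L = M.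
Proof.
have [t t_gt0 plsG] := finite_plane_regular q_ge2 plane => LLL MLL LG LM.
have : 1 < #|L :&: PPi| by rewrite (card_line plsG LG).
case/card_gt1P=> x [y [xL yL xy]].
have [xM yM] : x \in M /\ y \in M by move: xL yL; rewrite LM !inE => /andP[? _] /andP[].
by move: xL yL; rewrite !inE => /andP[? _] /andP[? _]; apply: (line_eq pls (x := x) (y := y)).
Qed.

Lemma trace_exists g : g \in GG -> exists2 L, L \in LL & L :&: PPi = g.
Proof.
by have [_ ->] := sub => /imsetP[L]; rewrite inE => /andP[LLL _] ->; exists L.
Qed.

Lemma line_extP g : g \in GG -> line_ext LL PPi g \in LL /\ line_ext LL PPi g :&: PPi = g.
Proof.
move=> /trace_exists[L LLL LE]; rewrite /line_ext; case: pickP => [M /andP[MLL /eqP]//|].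
by move=> /(_ L); rewrite /= LLL LE eqxx.
Qed.

Lemma line_ext_trace L : L \in LL -> L :&: PPi \in GG -> line_ext LL PPi (L :&: PPi) = L.
Proof. by move=> LLL LG; have [? E] := line_extP LG; apply: trace_inj; rewrite ?E. Qed.

Lemma collinear_plane x y : x \in PPi -> y \in PPi -> collinear LL x y.
Proof.
move=> xP yP; have /existsP[g /and3P[gG xg yg]] := plane_collinear q_ge2 plane xP yP.
have [L LLL LE] := trace_exists gG; apply/existsP; exists L; rewrite LLL.
by move: xg yg; rewrite -LE !inE => /andP[-> _] /andP[->].
Qed.

End Subspaces.

(** * Common neighbours after twisting *)

Section TwistedAdjacency.
Variables (T : finType) (LL : {set {set T}}) (q beta : nat).
(** Twisting is treated abstractly: [tw L] agrees with [L] off the plane and with the line [phi L]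
    on it, where [phi] permutes the lines and keeps the sizes of their intersections inside the
    plane. The number [k] is the size of a plane line. *)
Variables (PPi : {set T}) (k : nat) (tw phi : {set T} -> {set T}).
Hypothesis pls : regular_pls q beta [set: T] LL.
Hypothesis plane_coll : {in PPi &, forall x y, collinear LL x y}.
Hypothesis card_trace : forall L x, L \in LL -> x \in L -> x \in PPi -> #|L :&: PPi| = k.
Hypothesis tw_out : forall L z, L \in LL -> z \notin PPi -> (z \in tw L) = (z \in L).
Hypothesis tw_in : forall L z, L \in LL -> z \in PPi -> (z \in tw L) = (z \in phi L).
Hypothesis phi_line : forall L, L \in LL -> phi L \in LL.
Hypothesis phi_inj : {in LL &, injective phi}.
Hypothesis phi_meet : forall L M, L \in LL -> M \in LL ->
  #|phi L :&: phi M :&: PPi| = #|L :&: M :&: PPi|.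

Definition copy (L : {set T}) (eps : bool) := if eps then L else tw L.

Definition joined : rel (T * bool) := fun v w =>
  (v.1 \in PPi) && (w.1 \in PPi) ||
  [exists L in LL, (v.1 \in copy L v.2) && (w.1 \in copy L w.2)].

Definition joined_graph : rel (T * bool) := fun v w => (v != w) && joined v w.

Lemma joined_sym v w : joined v w = joined w v.
Proof.
congr (_ || _); first by rewrite andbC.
by apply: eq_existsb => L; rewrite [X in _ && X]andbC.
Qed.

Lemma copy_out L eps z : L \in LL -> z \notin PPi -> (z \in copy L eps) = (z \in L).
Proof. by case: eps => //=; exact: tw_out. Qed.

Lemma joined_refl v : joined v v.
Proof.
case: v => x eps; rewrite /joined /= andbb; have [//|xP] := boolP (x \in PPi).
have /existsP[L /and3P[LLL xL _]] := collinear_refl pls x.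
by apply/existsP; exists L; rewrite LLL copy_out // xL.
Qed.

Lemma lambda_joined_graph v w : v != w -> joined v w ->
  lambda joined_graph v w + 2 =
    #|[set z | joined v (z, true) && joined w (z, true)]| +
    #|[set z | joined v (z, false) && joined w (z, false)]|.
Proof.
move=> vw rvw; rewrite -(card_pair_bool (fun z => joined v z && joined w z)).
apply: lambda_closed_nbhd => //; first exact: joined_refl.
by rewrite joined_sym.
Qed.

(** Making the plane a clique adds no edge inside the untwisted copy, since plane points are already
    collinear. *)
Lemma joined_plus x z : joined (x, true) (z, true) = collinear LL x z.
Proof.
rewrite /joined /=; case: (boolP (x \in PPi)) => //= xP.
by case: (boolP (z \in PPi)) => //= zP; rewrite plane_coll.
Qed.

Lemma joined_out x z eps eps' : x \notin PPi -> joined (x, eps) (z, eps') =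
  [exists L in pencil LL x, z \in copy L eps'].
Proof.
move=> xP; rewrite /joined /= (negbTE xP) /=; apply: eq_existsb => L.
by rewrite mem_pencil; case: (boolP (L \in LL)) => //= LLL; rewrite copy_out.
Qed.

(* The plane itself enters as the extra line [None] through each of its points. *)
Let cells (x : T) : {set option {set T}} :=
  if x \in PPi then [set None] else [set Some L | L in pencil LL x].
Let cell (f : {set T} -> {set T}) (o : option {set T}) : {set T} :=
  if o is Some L then f L else setT.

Let cellsP x o : o \in cells x -> if o is Some L then L \in pencil LL x /\ x \notin PPi
  else x \in PPi.
Proof.
rewrite /cells; case: ifPn => xP; first by rewrite inE => /eqP ->.
by case/imsetP=> L Lx ->.
Qed.

Let exists_cells f x z :
  [exists o in cells x, z \in cell f o] = (x \in PPi) || [exists L in pencil LL x, z \in f L].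
Proof.
rewrite /cells; case: ifPn => xP /=.
  by apply/existsP; exists None; rewrite !inE.
apply/existsP/existsP => [[o /andP[/imsetP[L Lx ->] zL]]|[L /andP[Lx zL]]].
  by exists L; rewrite Lx.
by exists (Some L); rewrite imset_f.
Qed.

Let disjoint_cells x : disjoint_on PPi (cell id) (cells x).
Proof.
move=> z o o' zP /cellsP + /cellsP; case: o => [L|]; case: o' => [M|] //=.
- move=> [Lx xP] [Mx _] zL zM; congr Some; exact: (pencil_disjoint pls xP zP).
- by move=> [_ /negP].
- by move=> ? [_ /negP].
Qed.

(** If [phi L] and [phi M] share a plane point, then so do L and M by [phi_meet]; two lines through
    a point x off the plane then coincide. *)
Let disjoint_cells_phi x : disjoint_on PPi (cell phi) (cells x).
Proof.
move=> z o o' zP /cellsP + /cellsP; case: o => [L|]; case: o' => [M|] //=.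
- move=> [Lx xP] [Mx _] zL zM; congr Some.
  move: (Lx) (Mx); rewrite !mem_pencil => /andP[LLL _] /andP[MLL _].
  have : 0 < #|L :&: M :&: PPi|.
    by rewrite -phi_meet // card_gt0; apply/set0Pn; exists z; rewrite !inE zL zM.
  rewrite card_gt0 => /set0Pn[y]; rewrite !inE => /andP[/andP[yL yM] yP].
  exact: (pencil_disjoint pls xP yP).
- by move=> [_ /negP].
- by move=> ? [_ /negP].
Qed.

Let cell_meet x y o o' : o \in cells x -> o' \in cells y ->
  #|cell phi o :&: cell phi o' :&: PPi| = #|cell id o :&: cell id o' :&: PPi|.
Proof.
have phi_size L : L \in LL -> #|phi L :&: PPi| = #|L :&: PPi|.
  by move=> LLL; have := phi_meet LLL LLL; rewrite !setIid.
move=> /cellsP + /cellsP; case: o => [L|]; case: o' => [M|] //=.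
- by rewrite !mem_pencil => -[/andP[? _] _] [/andP[? _] _]; exact: phi_meet.
- by rewrite mem_pencil !setIT => -[/andP[? _] _] _; exact: phi_size.
- by rewrite mem_pencil !setTI => _ [/andP[? _] _]; exact: phi_size.
Qed.

Lemma joined_minus x z : z \in PPi ->
  joined (x, true) (z, false) = [exists o in cells x, z \in cell phi o].
Proof.
move=> zP; rewrite exists_cells /joined /= zP andbT; congr (_ || _).
apply: eq_existsb => L; rewrite mem_pencil andbA; apply: andb_id2l => /andP[LLL _].
by rewrite tw_in.
Qed.

(* Twisting permutes the plane lines without changing how many points two of them share,
   so it does not change how many points of the plane see both x and y. *)
Lemma card_joined_minus x y :
  #|[set z | joined (x, true) (z, false) && joined (y, true) (z, false)]| =
  #|[set z | collinear LL x z && collinear LL y z]|.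
Proof.
rewrite (card_split PPi) [RHS](card_split PPi); congr (_ + _); last first.
  (* Off the plane a line and its twist have the same points, so the two counts agree pointwise
     there. *)
  apply: eq_card => z; rewrite !inE; case: (boolP (z \in PPi)) => //= zP.
  have outE u : joined (u, true) (z, false) = collinear LL u z.
    by rewrite joined_sym joined_out // -collinear_pencil collinear_sym.
  by rewrite !outE.
have -> : [set z in PPi | joined (x, true) (z, false) && joined (y, true) (z, false)]
    = PPi :&: meeting_set (cell phi) (cells x) (cells y).
  by apply/setP=> z; rewrite !inE; apply: andb_id2l => zP; rewrite !joined_minus.
have -> : [set z in PPi | collinear LL x z && collinear LL y z]
    = PPi :&: meeting_set (cell id) (cells x) (cells y).
  apply/setP=> z; rewrite !inE; apply: andb_id2l => zP.
  have collE u : collinear LL u z = [exists o in cells u, z \in cell id o].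
    rewrite exists_cells -collinear_pencil.
    by case: (boolP (u \in PPi)) => //= uP; rewrite plane_coll.
  by rewrite !collE.
rewrite !card_meeting_disjoint //; apply: eq_bigr => o ox; apply: eq_bigr => o' oy.
exact: cell_meet ox oy.
Qed.

(** Each copy of P contains lambda + 2 common closed neighbours, which gives 2 (lambda + 2) - 2. *)
Lemma lambda_joined_plus x y : x != y -> collinear LL x y ->
  lambda joined_graph (x, true) (y, true) = 2 * lambda (point_graph LL) x y + 2.
Proof.
move=> xy cxy.
have /= := @lambda_joined_graph (x, true) (y, true).
rewrite xpair_eqE /= andbT joined_plus => /(_ xy cxy).
have -> : [set z | joined (x, true) (z, true) && joined (y, true) (z, true)]
    = [set z | collinear LL x z && collinear LL y z].
  by apply/setP=> z; rewrite !inE !joined_plus.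
rewrite card_joined_minus -(lambda_point_graph pls xy cxy); lia.
Qed.

(** The two copies of a point off the plane have the same closed neighbourhood, with at least (q +
    1) beta + 1 points in each copy of P. *)
Lemma lambda_joined_twin x : x \notin PPi ->
  joined_graph (x, true) (x, false) /\
  2 * ((q + 1) * beta) <= lambda joined_graph (x, true) (x, false).
Proof.
move=> xP; have joinE eps w : joined (x, eps) w = joined (x, true) w.
  by case: w => z eps'; rewrite !joined_out.
have jxx : joined (x, true) (x, false) by rewrite joined_sym joinE joined_refl.
split; first by rewrite /joined_graph xpair_eqE andbF.
have /= := @lambda_joined_graph (x, true) (x, false).
rewrite xpair_eqE andbF => /(_ isT jxx).
have := card_joined_minus x x; have := card_collinear pls x.
have -> : [set z | joined (x, true) (z, true) && joined (x, false) (z, true)]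
    = [set z | collinear LL x z].
  by apply/setP=> z; rewrite !inE [joined (x, false) _]joinE andbb joined_plus.
have -> : [set z | joined (x, true) (z, false) && joined (x, false) (z, false)]
    = [set z | joined (x, true) (z, false) && joined (x, true) (z, false)].
  by apply/setP=> z; rewrite !inE [joined (x, false) _]joinE.
have -> : [set z | collinear LL x z && collinear LL x z] = [set z | collinear LL x z].
  by apply/setP=> z; rewrite !inE andbb.
lia.
Qed.

(** For y in the plane these are the labels L with x on [L] and y on [tw L]; their number is the c
    of the overview. *)
Definition common_lines (x y : T) : {set {set T}} :=
  [set L in pencil LL x | y \in phi L].

Lemma card_twisted_pencil y : #|[set M in LL | y \in phi M]| <= q + 1.
Proof.
rewrite addn1 -(card_pencil pls (in_setT y)) -(@card_in_imset _ _ phi); last first.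
  by move=> L M; rewrite !inE => /andP[LLL _] /andP[MLL _]; apply: phi_inj.
apply/subset_leq_card/subsetP=> _ /imsetP[M + ->].
by rewrite inE mem_pencil => /andP[MLL ->]; rewrite phi_line.
Qed.

Lemma lambda_joined_plane x y : x \in PPi -> y \in PPi ->
  let c := #|common_lines x y| in
  joined_graph (x, true) (y, false) /\
  2 * #|PPi| + 2 * (c * (beta + 1 - k)) <= lambda joined_graph (x, true) (y, false) + 2
    <= 2 * #|PPi| + 2 * (c * (beta + 1 - k) + (q + 1) ^ 2).
Proof.
move=> xP yP c; have jxy : joined (x, true) (y, false) by rewrite /joined /= xP yP.
split; first by rewrite /joined_graph xpair_eqE andbF.
have /= := @lambda_joined_graph (x, true) (y, false).
rewrite xpair_eqE andbF => /(_ isT jxy) ->.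
pose A := pencil LL x; pose B := [set M in LL | y \in phi M].
pose Z := ~: PPi :&: meeting_set id A B.
(* The plane consists of common neighbours. Off the plane the two copies of a line agree, so [Z]
   serves for both signs. *)
have splitE eps :
    #|[set z | joined (x, true) (z, eps) && joined (y, false) (z, eps)]| = #|PPi| + #|Z|.
  rewrite (card_split PPi); congr (_ + _); apply: eq_card => z; rewrite !inE.
    by case: (boolP (z \in PPi)) => //= zP; rewrite /joined /= xP yP zP.
  case: (boolP (z \in PPi)) => //= zP.
  rewrite [joined (x, true) _]joined_sym [joined (y, false) _]joined_sym !joined_out //.
  congr (_ && _); apply: eq_existsb => L; rewrite !inE /=.
    by rewrite andbAC.
  by case: (boolP (L \in LL)) => //= LLL; rewrite tw_in // andbC.
rewrite !splitE.
have sumE : \sum_(L in A :&: B) #|~: PPi :&: L| = c * (beta + 1 - k).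
  rewrite (eq_bigr (fun=> beta + 1 - k)) => [|L]; last first.
    rewrite !inE => /andP[/andP[LLL xL] _].
    have := cardsID PPi L; rewrite (card_trace LLL xL xP) (card_line pls LLL) setIC -setDE; lia.
  rewrite sum_nat_const; congr (_ * _); apply: eq_card => L.
  by rewrite !inE; case: (L \in LL).
(* The common lines all pass through the plane point x, so they are disjoint off the plane and their
   contributions add up. *)
have low : c * (beta + 1 - k) <= #|Z|.
  rewrite -sumE; apply: card_meeting_lower => z L M zP; rewrite !inE.
  move=> /andP[/andP[LLL xL] _] /andP[/andP[MLL xM] _] zL zM.
  by apply: (line_eq pls (x := x) (y := z)) => //; apply: contraTneq zP => <-; rewrite inE xP.
have upp : #|Z| <= c * (beta + 1 - k) + (q + 1) ^ 2.
  have meet1 (L M : {set T}) : L \in A -> M \in B -> L != M -> #|L :&: M| <= 1.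
    by rewrite !inE => /andP[? _] /andP[? _]; exact: (lines_meet pls).
  apply: leq_trans (card_meeting_upper (f := id) (~: PPi) meet1) _.
  rewrite sumE leq_add2l expnS expn1 leq_mul ?card_twisted_pencil //.
  by rewrite (card_pencil pls) // addn1.
lia.
Qed.

End TwistedAdjacency.

(** * Twisting the labelled lines *)

Section Twisting.
Variables (T : finType) (LL : {set {set T}}) (q beta : nat).
Variables (PPi : {set T}) (GG : {set {set T}}).
Hypothesis q_ge2 : 2 <= q.
Hypothesis pls : regular_pls q beta [set: T] LL.
Hypothesis plane : finite_plane q PPi GG.
Hypothesis sub : subspace PPi GG [set: T] LL.
Variables (l0 : {set T}) (u : 'I_q -> T) (l : 'I_q -> 'I_q -> {set T}).
Hypothesis lab : plane_labelling PPi GG l0 u l.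

Let tw := twisted_line LL PPi l q./2 q./2.

Definition swapped (a b : 'I_q) : bool :=
  twist_index q./2 q./2 a b || twist_index q./2 q./2 (rev_ord a) b.

Definition lext (a b : 'I_q) : {set T} := line_ext LL PPi (l a b).

(* Twisting exchanges the traces of the two lines of a twisted pair on the plane; [swap]
   exchanges the two lines themselves. *)
Definition swap (L : {set T}) : {set T} :=
  if [pick ab : 'I_q * 'I_q | swapped ab.1 ab.2 && (L == lext ab.1 ab.2)] is Some (a, b)
  then lext (rev_ord a) b else L.

(** Since j = i, the last row of the staircase is complete and the twisted pairs form a full
    triangle. *)
Lemma twist_index_half (a b : 'I_q) :
  twist_index q./2 q./2 a b = (a < q./2) && (b <= a).
Proof. rewrite /twist_index; lia. Qed.

Lemma swapped_rev a b : swapped (rev_ord a) b = swapped a b.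
Proof. by rewrite /swapped rev_ordK orbC. Qed.

Lemma pencil_labelled a : pencil GG (u a) = l0 |: [set l a b | b : 'I_q].
Proof. by have [_ _ _ -> _] := lab. Qed.

Lemma base_in_plane : l0 \in GG.
Proof. by have [] := lab. Qed.

Lemma point_on_base a : u a \in l0.
Proof. by have [] := lab. Qed.

Lemma plane_line_sub g x : g \in GG -> x \in g -> x \in PPi.
Proof.
have [t _ plsG] := finite_plane_regular q_ge2 plane.
by move=> gG; apply: (subsetP (line_sub plsG gG)).
Qed.

Lemma point_in_plane a : u a \in PPi.
Proof. exact: plane_line_sub base_in_plane (point_on_base a). Qed.

Lemma labelled_in_plane a b : l a b \in GG.
Proof.
have : l a b \in pencil GG (u a) by rewrite pencil_labelled setU1r ?imset_f.
by rewrite mem_pencil => /andP[].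
Qed.

Lemma point_on_labelled a b : u a \in l a b.
Proof.
have : l a b \in pencil GG (u a) by rewrite pencil_labelled setU1r ?imset_f.
by rewrite mem_pencil => /andP[].
Qed.

(** The pencil of [u a] has q + 1 lines, so the q + 1 names listing it cannot repeat. *)
Lemma labelled_row a : l0 \notin [set l a b | b : 'I_q] /\ injective (l a).
Proof.
have [t _ plsG] := finite_plane_regular q_ge2 plane.
have := card_pencil plsG (point_in_plane a); rewrite pencil_labelled cardsU1.
have le_q : #|[set l a b | b : 'I_q]| <= q by rewrite -[X in _ <= X]card_ord leq_imset_card.
case: (l0 \notin _) => /=; last first.
  by rewrite add0n => E; have := leq_trans (eq_leq (esym E)) le_q; rewrite ltnn.
rewrite add1n => -[card_q]; split=> //.
have /imset_injP : #|[set l a b | b : 'I_q]| == #|'I_q| by rewrite card_q card_ord.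
by move=> inj b b'; apply: inj.
Qed.

Lemma labelled_neq_base a b : l a b != l0.
Proof.
have [+ _] := labelled_row a; apply: contraNneq => <-; exact: imset_f.
Qed.

Lemma point_labelled_inj a a' b : u a' \in l a b -> a' = a.
Proof.
have [t _ plsG] := finite_plane_regular q_ge2 plane; have [_ u_inj _ _ _] := lab.
move=> ua'; apply/eqP/negPn/negP => aa'; case/negP: (labelled_neq_base a b).
apply/eqP/(line_eq plsG (x := u a) (y := u a')).
- exact: labelled_in_plane.
- exact: base_in_plane.
- by rewrite (inj_eq u_inj) eq_sym.
- exact: point_on_labelled.
- exact: ua'.
- exact: point_on_base.
- exact: point_on_base.
Qed.

Lemma labelled_inj a b a' b' : l a b = l a' b' -> a = a' /\ b = b'.
Proof.
move=> E; have aa' : a = a'.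
  by apply: (@point_labelled_inj _ _ b'); rewrite -E point_on_labelled.
by move: E; rewrite -aa' => E; split=> //; have [_] := labelled_row a; apply.
Qed.

Lemma lext_line a b : lext a b \in LL.
Proof. by have [] := line_extP sub (labelled_in_plane a b). Qed.

Lemma lext_trace a b : lext a b :&: PPi = l a b.
Proof. by have [] := line_extP sub (labelled_in_plane a b). Qed.

Lemma lext_in a b z : z \in PPi -> (z \in lext a b) = (z \in l a b).
Proof. by move=> zP; rewrite -lext_trace inE zP andbT. Qed.

Lemma lext_inj a b a' b' : lext a b = lext a' b' -> a = a' /\ b = b'.
Proof. by move=> E; apply: labelled_inj; rewrite -!lext_trace E. Qed.

(** A line determines its label, so the choice made by [pick] is forced. *)
Lemma pick_lext a b : swapped a b ->
  [pick ab : 'I_q * 'I_q | swapped ab.1 ab.2 && (lext a b == lext ab.1 ab.2)] = Some (a, b).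
Proof.
move=> sab; case: pickP => [[a' b'] /= /andP[_ /eqP/lext_inj[-> ->]]//|].
by move=> /(_ (a, b)); rewrite /= sab eqxx.
Qed.

Lemma swap_lext a b : swapped a b -> swap (lext a b) = lext (rev_ord a) b.
Proof. by move=> sab; rewrite /swap pick_lext. Qed.

Lemma twisted_lext a b : swapped a b ->
  tw (lext a b) = (lext a b :\: l a b) :|: l (rev_ord a) b.
Proof. by move=> sab; rewrite /tw /twisted_line pick_lext. Qed.

Lemma swapP L : (exists a b, swapped a b /\ L = lext a b) \/ (swap L = L /\ tw L = L).
Proof.
rewrite /swap /tw /twisted_line -/(lext _ _); case: pickP => [[a b] /= /andP[sab /eqP ->]|none].
  by left; exists a, b.
by right; split=> //; case: pickP => // ab /=; rewrite -/(lext _ _) -/(swapped _ _) none.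
Qed.

Lemma swap_lext_fixed a b : ~~ swapped a b -> swap (lext a b) = lext a b.
Proof.
move=> sab; have [[a' [b' [+ /lext_inj[aa' bb']]]]|[//]] := swapP (lext a b).
by rewrite -aa' -bb' (negbTE sab).
Qed.

Lemma swap_line L : L \in LL -> swap L \in LL.
Proof.
by have [[a [b [sab ->]]]|[-> _]] := swapP L; rewrite // swap_lext // lext_line.
Qed.

Lemma swapK : involutive swap.
Proof.
move=> L; have [[a [b [sab ->]]]|[E _]] := swapP L; last by rewrite !E.
by rewrite swap_lext // swap_lext ?swapped_rev // rev_ordK.
Qed.

Lemma tw_out L z : L \in LL -> z \notin PPi -> (z \in tw L) = (z \in L).
Proof.
move=> _ zP; have [[a [b [sab ->]]]|[_ ->]] := swapP L => //.
have notin a' : z \in l a' b = false.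
  by apply: contraNF zP; apply: plane_line_sub (labelled_in_plane a' b).
by rewrite twisted_lext // !inE !notin orbF.
Qed.

Lemma tw_in L z : L \in LL -> z \in PPi -> (z \in tw L) = (z \in swap L).
Proof.
move=> _ zP; have [[a [b [sab ->]]]|[-> ->]] := swapP L => //.
by rewrite twisted_lext // swap_lext // !inE !lext_in //; case: (z \in l a b).
Qed.

Lemma swap_trace L : L :&: PPi \in GG -> swap L :&: PPi \in GG.
Proof.
have [[a [b [sab ->]]]|[-> _]] := swapP L => // _.
by rewrite swap_lext // lext_trace labelled_in_plane.
Qed.

(** In the affine case lines with the same second label are parallel, so twisting moves a trace only
    within its parallel class. *)
Lemma swap_parallel L : affine_plane q PPi GG -> parallel (swap L :&: PPi) (L :&: PPi).
Proof.
move=> aff; have [_ _ _ _ /(_ aff) dis] := lab.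
have [[a [b [sab ->]]]|[-> _]] := swapP L; last by rewrite /parallel eqxx.
rewrite swap_lext // !lext_trace /parallel.
by case: (eqVneq (rev_ord a) a) => [->|ne]; rewrite ?eqxx // dis ?orbT.
Qed.

Lemma trace_dichotomy L : L \in LL -> L :&: PPi = set0 \/ L :&: PPi \in GG.
Proof.
move=> LLL; have [|[x]] := set_0Vmem (L :&: PPi); first by left.
by rewrite inE => /andP[xL xP]; right; apply: (trace_mem q_ge2 pls plane sub LLL xL xP).
Qed.

Lemma swap_parallel_traces L M : L \in LL -> M \in LL -> L != M ->
  L :&: PPi \in GG -> M :&: PPi \in GG -> affine_plane q PPi GG ->
  parallel (L :&: PPi) (M :&: PPi) -> parallel (swap L :&: PPi) (swap M :&: PPi).
Proof.
move=> LLL MLL LM LG MG aff par.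
apply: (parallel_trans aff (swap_trace LG) LG) => //; first exact: swap_trace.
  exact: swap_parallel.
apply: (parallel_trans aff LG MG) => //; first exact: swap_trace.
by rewrite parallel_sym; exact: swap_parallel.
Qed.

(** Distinct lines of a projective plane always meet in one point. In an affine plane they meet in
    at most one, and in none exactly when they are parallel, a relation that swapping preserves. *)
Lemma swap_meet L M : L \in LL -> M \in LL ->
  #|swap L :&: swap M :&: PPi| = #|L :&: M :&: PPi|.
Proof.
have [t _ plsG] := finite_plane_regular q_ge2 plane.
move=> LLL MLL.
have empty N : N \in LL -> N :&: PPi = set0 -> swap N = N.
  move=> _ N0; have [[a [b [_ E]]]|[]//] := swapP N.
  by have := point_on_labelled a b; rewrite -lext_trace -E N0 inE.
have meetE A B : A :&: B :&: PPi = (A :&: PPi) :&: (B :&: PPi) by rewrite setIACA setIid.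
have [L0|LG] := trace_dichotomy LLL.
  by rewrite !meetE (empty L) // L0 !set0I.
have [M0|MG] := trace_dichotomy MLL.
  by rewrite !meetE (empty M) // M0 !setI0.
case: (eqVneq L M) => [<-|LM].
  by rewrite !setIid (card_line plsG LG) (card_line plsG (swap_trace LG)).
have trace_neq A B : A \in LL -> B \in LL -> A :&: PPi \in GG -> A != B ->
    A :&: PPi != B :&: PPi.
  by move=> ALL BLL AG; apply: contra_neq; apply: (trace_inj q_ge2 pls plane).
have sLM : swap L != swap M by rewrite (inj_eq (inv_inj swapK)).
have [sLL sML] := (swap_line LLL, swap_line MLL).
have [sLG sMG] := (swap_trace LG, swap_trace MG).
have neq := trace_neq _ _ LLL MLL LG LM; have sneq := trace_neq _ _ sLL sML sLG sLM.
rewrite !meetE; case: plane => [aff|[_ meet1]]; last by rewrite !meet1.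
have := lines_meet plsG LG MG neq; have := lines_meet plsG sLG sMG sneq.
have meet0 A B : A :&: PPi != B :&: PPi ->
    (#|(A :&: PPi) :&: (B :&: PPi)| == 0) = parallel (A :&: PPi) (B :&: PPi).
  by move=> /negbTE ne; rewrite cards_eq0 setI_eq0 /parallel ne.
(* One implication is [swap_parallel_traces]; the other is the same lemma applied to the swapped
   lines, as [swap] is an involution. *)
have : (#|(swap L :&: PPi) :&: (swap M :&: PPi)| == 0) = (#|(L :&: PPi) :&: (M :&: PPi)| == 0).
  rewrite !meet0 //; apply/idP/idP => par; last exact: swap_parallel_traces.
  by rewrite -(swapK L) -(swapK M); apply: swap_parallel_traces.
by case: #|_| => [|[|]] //; case: #|_| => [|[|]].
Qed.

(** * Counting common lines of plane points *)

Lemma swap_base : swap (line_ext LL PPi l0) = line_ext LL PPi l0.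
Proof.
have [[a [b [_ E]]]|[]//] := swapP (line_ext LL PPi l0).
have [_ t0] := line_extP sub base_in_plane.
by have := labelled_neq_base a b; rewrite -lext_trace -E t0 eqxx.
Qed.

Lemma pencil_lext a : pencil LL (u a) = line_ext LL PPi l0 |: [set lext a b | b : 'I_q].
Proof.
have [LL0 t0] := line_extP sub base_in_plane.
have uP := point_in_plane a.
apply/setP=> L; rewrite mem_pencil; apply/andP/setU1P => [[LLL uL]|[->|/imsetP[b _ ->]]].
- have LG := trace_mem q_ge2 pls plane sub LLL uL uP.
  have : L :&: PPi \in pencil GG (u a) by rewrite mem_pencil LG inE uL uP.
  rewrite pencil_labelled => /setU1P[E|/imsetP[b _ E]].
    by left; rewrite -(line_ext_trace q_ge2 pls plane sub LLL LG) E.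
  right; apply/imsetP; exists b => //.
  by rewrite -(line_ext_trace q_ge2 pls plane sub LLL LG) E.
- have : u a \in line_ext LL PPi l0 :&: PPi by rewrite t0 point_on_base.
  by rewrite inE => /andP[].
by rewrite lext_line lext_in // point_on_labelled.
Qed.

Lemma card_common_lines a y : y \in PPi ->
  #|common_lines LL swap (u a) y| = (y \in l0) + #|[set b | y \in swap (lext a b)]|.
Proof.
move=> yP; have [LL0 t0] := line_extP sub base_in_plane.
have y0 : (y \in line_ext LL PPi l0) = (y \in l0) by rewrite -[in RHS]t0 inE yP andbT.
have base_new : line_ext LL PPi l0 \notin [set lext a b | b : 'I_q].
  apply/imsetP=> -[b _ E]; have := labelled_neq_base a b.
  by rewrite -lext_trace -E t0 eqxx.
have lext_a_inj : injective (lext a) by move=> b b' /lext_inj[].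
rewrite -(card_imset _ lext_a_inj).
have -> : common_lines LL swap (u a) y =
    [set L in [set line_ext LL PPi l0] | y \in l0] :|:
    [set lext a b | b in [set b | y \in swap (lext a b)]].
  apply/setP=> L; rewrite /common_lines pencil_lext !inE.
  case: (eqVneq L (line_ext LL PPi l0)) => [->|ne] /=.
    rewrite swap_base y0; case: (y \in l0) => //=; apply/esym/negbTE.
    by apply: contra base_new => /imsetP[b _ ->]; apply: imset_f.
  apply/andP/imsetP => [[/imsetP[b _ ->] yb]|[b]]; first by exists b; rewrite ?inE.
  by rewrite inE => yb ->; split=> //; apply: imset_f.
rewrite cardsU (_ : _ :&: _ = set0) ?cards0 ?subn0.
  congr (_ + _); case: (y \in l0).
    apply: etrans (cards1 (line_ext LL PPi l0)).
    by apply: eq_card => L; rewrite !inE andbT.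
  by apply/eqP; rewrite cards_eq0; apply/eqP/setP=> L; rewrite !inE andbF.
apply/setP=> L; rewrite !inE; apply/negP => /andP[/andP[/eqP -> _]] /imsetP[b _ E].
by case/negP: base_new; rewrite E; apply: imset_f.
Qed.

Lemma card_ord_leq n (a : nat) : a < n -> #|[set b : 'I_n | b <= a]| = a.+1.
Proof.
move=> a_n; have widen_inj : injective (widen_ord a_n) by move=> i j [ij]; apply: val_inj.
rewrite -[RHS]card_ord -(card_imset _ widen_inj).
apply: eq_card => b; rewrite inE; apply/idP/imsetP => [ba|[i _ ->]]; last by rewrite -ltnS /=.
by exists (Ordinal (ba : b < a.+1)) => //; apply: val_inj.
Qed.

Lemma swapped_small (a b : 'I_q) : a < q./2 -> swapped a b = (b <= a).
Proof. by move=> a_small; rewrite /swapped !twist_index_half /=; lia. Qed.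

(** The base line and the q - a - 1 untwisted lines of row a still contain [u a]; the a + 1 twisted
    ones now pass through [u (rev_ord a)]. *)
Lemma common_lines_twin (a : 'I_q) : a < q./2 ->
  #|common_lines LL swap (u a) (u a)| = q - a.
Proof.
move=> a_small; rewrite card_common_lines ?point_in_plane // point_on_base.
have ne : rev_ord a <> a by move=> /(congr1 val) /=; lia.
have -> : [set b | u a \in swap (lext a b)] = ~: [set b : 'I_q | b <= a].
  apply/setP=> b; rewrite !inE -swapped_small //.
  have [sab|sab] := boolP (swapped a b).
    rewrite swap_lext // lext_in ?point_in_plane //; apply/negbTE/negP.
    by move=> /point_labelled_inj E; case: ne.
  by rewrite swap_lext_fixed // lext_in ?point_in_plane // point_on_labelled.
have := cardsC [set b : 'I_q | b <= a]; rewrite card_ord card_ord_leq //.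
have := ltn_ord a; lia.
Qed.

(** The base line and the a + 1 twisted lines of row a are the common ones. *)
Lemma common_lines_opposite (a : 'I_q) : a < q./2 ->
  #|common_lines LL swap (u a) (u (rev_ord a))| = a + 2.
Proof.
move=> a_small; rewrite card_common_lines ?point_in_plane // point_on_base.
have ne : rev_ord a <> a by move=> /(congr1 val) /=; lia.
have -> : [set b | u (rev_ord a) \in swap (lext a b)] = [set b : 'I_q | b <= a].
  apply/setP=> b; rewrite !inE -swapped_small //.
  have [sab|sab] := boolP (swapped a b).
    by rewrite swap_lext // lext_in ?point_in_plane // point_on_labelled.
  rewrite swap_lext_fixed // lext_in ?point_in_plane //; apply/negbTE/negP.
  by move=> /point_labelled_inj.
rewrite card_ord_leq //; lia.
Qed.

Lemma common_lines_empty : exists x y, [/\ x \in PPi, y \in PPi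
  & #|common_lines LL swap x y| = 0].
Proof.
have [t _ plsG] := finite_plane_regular q_ge2 plane.
have q_gt0 : 0 < q by lia.
(* Indices start at 0: [a] is 0, used both as a row and as a label, and [b1] is 1. In row 0 only the
   label 0 is twisted. *)
pose a := Ordinal q_gt0; pose b1 : 'I_q := Ordinal q_ge2.
have ne : rev_ord a <> a by move=> /(congr1 val) /=; lia.
have meet : l a a :&: l (rev_ord a) b1 != set0.
  have neq : l a a != l (rev_ord a) b1 by apply/eqP=> /labelled_inj[/esym].
  case: (plane) => [aff|[_ meet1]]; last first.
    by rewrite -card_gt0 meet1 // labelled_in_plane.
  (* If the two lines were disjoint, [l (rev_ord a) b1] and [l (rev_ord a) a] would both be the
     parallel to [l a a] through [u (rev_ord a)]. *)
  have [_ _ _ _ /(_ aff) dis] := lab; rewrite setI_eq0; apply/negP => dis1.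
  have [_ par] := aff.
  have nin : u (rev_ord a) \notin l a a by apply/negP=> /point_labelled_inj.
  have [D [_ uniqD]] := par _ _ (point_in_plane (rev_ord a)) (labelled_in_plane a a) nin.
  have D1 : D = l (rev_ord a) b1.
    by apply: uniqD; rewrite labelled_in_plane point_on_labelled disjoint_sym.
  have : l (rev_ord a) b1 = l (rev_ord a) a.
    rewrite -D1; apply: uniqD; rewrite labelled_in_plane point_on_labelled.
    by split=> //; apply: dis; apply/eqP.
  by case/labelled_inj=> _ /(congr1 val).
have [y] := set0Pn _ meet; rewrite inE => /andP[ya yb1].
have yP := plane_line_sub (labelled_in_plane a a) ya.
have not_base : y \notin l0.
  apply/negP => y0; have uE c b : y \in l c b -> y = u c.
    move=> yc; apply/eqP/negPn/negP => yu; case/negP: (labelled_neq_base c b); apply/eqP.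
    by apply: (line_eq plsG (x := y) (y := u c));
      rewrite ?labelled_in_plane ?base_in_plane ?point_on_labelled ?point_on_base.
  have [_ u_inj _ _ _] := lab; apply: ne; apply: u_inj.
  by rewrite -(uE _ _ ya) -(uE _ _ yb1).
have two_lines c b b' : y \in l c b -> y \in l c b' -> b = b'.
  move=> yb yb'; apply: (proj2 (labelled_row c)).
  apply: (line_eq plsG (x := y) (y := u c));
    rewrite ?labelled_in_plane ?point_on_labelled //.
  by apply: contraNneq not_base => ->; rewrite point_on_base.
exists (u a), y; split=> //; first exact: point_in_plane.
rewrite card_common_lines // (negbTE not_base) add0n.
apply/eqP; rewrite cards_eq0; apply/eqP/setP=> b; rewrite !inE; apply/negP.
have half_gt0 : a < q./2 by rewrite /=; lia.
(* A twisted line of row 0 contains y only for the label 1, which is not twisted; an untwisted one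
   only for the label 0, which is twisted. *)
have [sab|sab] := boolP (swapped a b).
  rewrite swap_lext // lext_in // => /two_lines /(_ yb1) E.
  by move: sab; rewrite swapped_small // E.
rewrite swap_lext_fixed // lext_in // => /two_lines /(_ ya) E.
by move: sab; rewrite swapped_small // E.
Qed.

End Twisting.

(** * Assembling the levels of the twisted graph *)

Lemma lambda_level_twisted (T : finType) (LL : {set {set T}}) (q beta : nat)
    (PPi : {set T}) (GG : {set {set T}})
    (l0 : {set T}) (u : 'I_q -> T) (l : 'I_q -> 'I_q -> {set T}) :
  2 <= q ->
  regular_pls q beta [set: T] LL ->
  finite_plane q PPi GG ->
  subspace PPi GG [set: T] LL ->
  #|PPi| + (q + 1) ^ 2 <= beta ->
  plane_labelling PPi GG l0 u l ->
  lambda_level (point_graph LL) + q + 1 <= lambda_level (twisted_graph LL PPi l q./2 q./2).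
Proof.
move=> q_ge2 pls plane sub beta_large lab.
have [t t_gt0 plsG] := finite_plane_regular q_ge2 plane.
have coll := collinear_plane q_ge2 plane sub.
have trace L x : L \in LL -> x \in L -> x \in PPi -> #|L :&: PPi| = t.+1.
  by move=> LLL xL xP; apply: (card_line plsG); apply: (trace_mem q_ge2 pls plane sub LLL xL).
pose phi := swap LL PPi l; pose tw := twisted_line LL PPi l q./2 q./2.
have tw_out := tw_out q_ge2 plane sub lab.
have tw_in := tw_in q_ge2 plane sub lab.
have phi_line := swap_line q_ge2 plane sub lab.
have phi_inj : {in LL &, injective phi}.
  by move=> L M _ _; apply: inv_inj; apply: (swapK q_ge2 plane sub lab).
have phi_meet := swap_meet q_ge2 pls plane sub lab.
rewrite -[twisted_graph _ _ _ _ _]/(joined_graph LL PPi tw); set e := joined_graph LL PPi tw.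
pose vals n := exists v w, e v w /\ lambda e v w = n.
have t_small : t.+1 <= #|PPi|.
  have l0G := base_in_plane lab.
  by rewrite -(card_line plsG l0G) subset_leq_card // (line_sub plsG).
(* [D] counts the points off the plane on a line that meets it, and [E] bounds the error per copy.
   The bound on [beta] gives E < D. *)
pose D := beta + 1 - t.+1; pose E := (q + 1) ^ 2.
have in_plane x y : x \in PPi -> y \in PPi -> exists2 n, vals n &
    2 * #|PPi| + 2 * (#|common_lines LL phi x y| * D) <= n + 2
      <= 2 * #|PPi| + 2 * (#|common_lines LL phi x y| * D + E).
  move=> xP yP; have [exy bnd] :=
    lambda_joined_plane pls trace tw_out tw_in phi_line phi_inj xP yP.
  by exists (lambda e (x, true) (y, false)) => //; exists (x, true), (y, false).
have [x0 [y0 [x0P y0P c0]]] := common_lines_empty q_ge2 pls plane sub lab.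
have [v0 v0_val v0_bnd] := in_plane x0 y0 x0P y0P; rewrite c0 mul0n in v0_bnd.
have [x1 x1P] : exists x, x \notin PPi.
  have [L0 _] := line_extP sub (base_in_plane lab).
  apply/existsP; rewrite -negb_forall; apply/negP => /forallP allP.
  have : #|line_ext LL PPi l0| <= #|PPi| by apply/subset_leq_card/subsetP=> z _.
  by rewrite (card_line pls L0); lia.
have [v1_adj v1_low] := lambda_joined_twin pls coll tw_out tw_in phi_meet x1P.
rewrite -/e in v1_adj v1_low; set v1 := lambda e _ _ in v1_low.
(* For i < q - 1 the interval belongs to c = i + 2, so c runs from 2 to q; the last one is the
   single value of the twins off the plane. *)
pose lo i := if i < q.-1 then 2 * #|PPi| + 2 * ((i + 2) * D) - 2 else v1.
pose hi i := if i < q.-1 then 2 * #|PPi| + 2 * ((i + 2) * D + E) - 2 else v1.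
have [i i_q|i i_q|s' [s'_uniq s'_size s'_vals s'_bnd]] := @staircase vals lo hi q.
- rewrite /lo /hi; case: ifP => [i_small|_]; last first.
    by exists v1; [exists (x1, true), (x1, false) | rewrite leqnn].
  suff [x [y [xP yP cE]]] : exists x y, [/\ x \in PPi, y \in PPi
      & #|common_lines LL phi x y| = i + 2].
    have [n nv nb] := in_plane x y xP yP; exists n => //; rewrite cE in nb; lia.
  have uP := point_in_plane q_ge2 plane lab.
  case: (ltnP i q./2) => [i_half|half_i].
    exists (u (Ordinal i_q)), (u (rev_ord (Ordinal i_q))); split; rewrite ?uP //.
    by rewrite (common_lines_opposite q_ge2 pls plane sub lab).
  (* The value c = q - a of the twins [u a] equals i + 2 for this a. *)
  have a_q : q - i - 2 < q by lia.
  exists (u (Ordinal a_q)), (u (Ordinal a_q)); split; rewrite ?uP //.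
  by rewrite (common_lines_twin q_ge2 pls plane sub lab) /=; lia.
- rewrite /lo /hi (_ : i < q.-1); last by lia.
  case: ifP => [_|i1_q].
    rewrite (_ : (i.+1 + 2) * D = (i + 2) * D + D); last by rewrite addSn mulSn addnC.
    by move: ((i + 2) * D) => m; rewrite /D; lia.
  have -> : i + 2 = q by lia.
  (* Plane lines have at least two points, so D <= beta - 1; with |P_Pi| + E <= beta the interval
     for c = q ends below 2 (q + 1) beta. *)
  apply: leq_trans v1_low.
  have : q * D <= q * (beta - 1) by rewrite leq_mul2l; apply/orP; right; rewrite /D; lia.
  have : q * (beta - 1) = q * beta - q by rewrite mulnBr muln1.
  have : q * 1 <= q * beta by rewrite leq_mul2l; lia.
  have : (q + 1) * beta = q * beta + beta by rewrite mulnDl mul1n.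
  by move: (q * D) (q * beta) ((q + 1) * beta) (q * (beta - 1)) => *; lia.
have [sG [sG_uniq <- sG_vals]] := lambda_levelP (point_graph LL).
have sG_bnd n : n \in sG -> beta.+1 <= n + 2 <= beta.+1 + E.
  by move=> /sG_vals[x [y [/andP[xy cxy] <-]]]; apply: lambda_point_graph_bounds.
pose plus n := 2 * n + 2.
have lo0 : lo 0 = 2 * #|PPi| + 4 * D - 2.
  by rewrite /lo (_ : 0 < q.-1); lia.
have -> : size sG + q + 1 = size (v0 :: [seq plus n | n <- sG] ++ s').
  by rewrite /= size_cat size_map s'_size addn1.
apply: leq_lambda_level; last first.
  move=> n; rewrite inE mem_cat => /or3P[/eqP ->//|/mapP[m /sG_vals[x [y [/andP[xy cxy] <-]]] ->]|].
    exists (x, true), (y, true); split.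
      by apply/andP; rewrite xpair_eqE andbT (joined_plus _ coll).
    by rewrite (lambda_joined_plus pls coll tw_out tw_in phi_meet).
  exact: s'_vals.
have plus_inj : injective plus by move=> m n; rewrite /plus; lia.
(* Three ranges are disjoint: [v0] is below 2 beta, the levels from G lie between 2 beta and 2 beta
   + 2 E, and those of [s'] start at 2 |P_Pi| + 4 D - 2, which is larger. *)
rewrite /= cat_uniq map_inj_uniq // sG_uniq s'_uniq mem_cat negb_or andbT /=.
apply/andP; split; first (apply/andP; split).
- by apply/mapP=> -[m /sG_bnd]; rewrite /plus; lia.
- by apply/negP=> /s'_bnd; rewrite lo0 /D /E; lia.
apply/hasPn=> n /s'_bnd; rewrite lo0 => n_bnd.
by apply/mapP=> -[m /sG_bnd]; rewrite /plus; rewrite /D /E in n_bnd *; lia.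
Qed.

Theorem theorem4p10 (T : finType) (LL : {set {set T}}) (q beta : nat)
    (PPi : {set T}) (GG : {set {set T}}) (gamma : nat) :
  2 <= q ->
  regular_pls q beta [set: T] LL ->
  finite_plane q PPi GG ->
  subspace PPi GG [set: T] LL ->
  #|PPi| + (q + 1) ^ 2 <= beta ->
  lambda_level (point_graph LL) = gamma ->
  (forall (l0 : {set T}) (u : 'I_q -> T) (l : 'I_q -> 'I_q -> {set T}),
     plane_labelling PPi GG l0 u l ->
     gamma + q + 1 <= lambda_level (twisted_graph LL PPi l q./2 q./2))
  /\ (regular_graph (point_graph LL) ->
      lambda_level (clique_ext2 (point_graph LL)) <= gamma + 1).
Proof.
move=> q_ge2 pls plane sub beta_large <-; split=> [l0 u l lab|].
  exact: lambda_level_twisted q_ge2 pls plane sub beta_large lab.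
apply: lambda_level_clique_ext2 => [x|x y]; first by rewrite /point_graph eqxx.
by rewrite /point_graph eq_sym -!/(collinear LL _ _) collinear_sym.
Qed.
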